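(* Let $\omega\in\mathcal{B}'_0$ with $\omega(z)=c_1z+c_2z^2+c_3z^3+\cdots$. Then $$|c_1c_3-c_2^2|\le\frac{1}{12}(1-|c_1|^2)(3+|c_1|^2),\qquad 0\le|c_1|\le1,$$ and this estimate is sharp; that is, for every $t\in[0,1]$ there is a function in $\mathcal{B}'_0$ with $|c_1|=t$ for which equality holds.
   Context: Let $\mathbb{D}=\{z\in\mathbb{C}:|z|<1\}$. The class $\mathcal{B}'_0$ consists of all functions $\omega$ analytic in $\mathbb{D}$ of the form $\omega(z)=c_1z+c_2z^2+c_3z^3+\cdots$ (with $c_1,c_2,\ldots\in\mathbb{C}$, so $\omega(0)=0$) such that $|\omega'(z)|\le1$ for all $z\in\mathbb{D}$. *)

(* Defs.v *)
(* Stdlib reals with Coquelicot's complex numbers C = R * R. *)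
From Stdlib Require Import Reals.
From Coquelicot Require Import Coquelicot.
Open Scope R_scope.

Definition unit_disk (z : C) : Prop := Cmod z < 1.

(* The structures are given explicitly because C also carries a real normed
   module structure: differentiability here is over C. *)
Definition analytic_in_disk (f : C -> C) : Prop :=
  forall z : C, unit_disk z -> @ex_derive C_AbsRing C_NormedModule f z.

(* f(z) = c_1 z + c_2 z^2 + c_3 z^3 + ... on the disk; the sequence is indexed
   from 0, and its entry of index 0 is required to vanish. *)
Definition has_expansion (f : C -> C) (c : nat -> C) : Prop :=
  c 0%nat = 0%C /\
  forall z : C, unit_disk z -> @is_pseries C_AbsRing C_NormedModule c z (f z).

(* The class B'_0. [C_derive] is a total operator; it is the complex derivative
   at every point of the disk by analyticity. *)
Definition B0' (f : C -> C) : Prop :=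
  analytic_in_disk f /\
  (exists c : nat -> C, has_expansion f c) /\
  (forall z : C, unit_disk z -> Cmod (C_derive f z) <= 1).

(* Main.v *)
Require Import Defs.
From Stdlib Require Import Reals Lra Lia ClassicalEpsilon.
From Coquelicot Require Import Coquelicot.
Open Scope R_scope.

(** Write omega' (z) = a_0 + a_1 z + a_2 z^2 + ..., so that a_0 = c_1,
    a_1 = 2 c_2, a_2 = 3 c_3, and the Hankel determinant is
    c_1 c_3 - c_2^2 = a_0 a_2 / 3 - a_1^2 / 4.  The function omega' is
    bounded by 1 on the disk, and everything comes from the constraints which
    this imposes on (a_0, a_1, a_2).

    Multiplication by omega' does not increase the l^2 norm of the
    coefficients: if |G| <= |H| on the disk then, by Parseval on the circles
    |z| = r, the coefficients of G are dominated in l^2 by those of H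
    ([coeff_dominated]).  Parseval is used in its discrete form
    ([discrete_parseval]), averaging the partial sums over roots of unity of
    high order, so that no integral is needed.  For H a quadratic polynomial
    and G = omega' H this says that the 3 x 3 lower triangular Toeplitz matrix
    of (a_0, a_1, a_2) is a contraction ([toeplitz3_contraction_of_bounded]).

    Eliminating the test vector one coordinate at a time, each time by the
    discriminant of a nonnegative quadratic form, turns contractivity into
    Schur's inequalities ([toeplitz3_schur]): with q = 1 - |a_0|^2,
      |a_1| <= q   and   |q a_2 + conj(a_0) a_1^2| <= q^2 - |a_1|^2.
    With p = |a_0| the identity
      q (a_0 a_2 / 3 - a_1^2 / 4)
        = a_0 (q a_2 + conj(a_0) a_1^2) / 3 - (p^2 / 3 + q / 4) a_1^2
    bounds the determinant by an affine function of |a_1|^2 with nonnegative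
    slope, so |a_1| = q is the worst case, and its value is
    q (3 + p^2) / 12 ([toeplitz3_hankel_bound]).

    Equality therefore requires |a_1| = 1 - |a_0|^2, the equality case of the
    Schwarz-Pick lemma, which suggests omega' (z) = (z + t) / (1 + t z) as
    extremal function ([extremal_function]).  Both halves rest on termwise
    differentiation of complex power series ([is_derive_Cpseries]). *)

(** * Complex series *)

Notation Cseries := (@is_series C_AbsRing C_NormedModule).
Notation Cpseries := (@is_pseries C_AbsRing C_NormedModule).

Lemma pow_n_Cpow (z : C) (n : nat) : @pow_n C_Ring z n = (z ^ n)%C.
Proof. induction n as [|n IH]; [reflexivity|]. exact (f_equal (Cmult z) IH). Qed.

Lemma Cpseries_Cseries (c : nat -> C) (z l : C) :
  Cpseries c z l <-> Cseries (fun n => (z ^ n * c n)%C) l.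
Proof.
  unfold is_pseries; split; apply is_series_ext; intros n;
    [symmetry|]; exact (f_equal (fun w => w * c n)%C (eq_sym (pow_n_Cpow z n))).
Qed.

Lemma Cseries_incr_1 (u : nat -> C) (l : C) :
  Cseries u l -> Cseries (fun n => u (S n)) (l - u O)%C.
Proof.
  intros H. apply (@is_series_incr_1 C_AbsRing C_NormedModule u).
  change (Cseries u ((l - u O) + u O)%C). now replace ((l - u O) + u O)%C with l by ring.
Qed.

(** Majorants are summed over R, so that existence and size of all complex
    sums below reduce to real series. *)
Lemma Cmod_Cseries_le (u : nat -> C) (v : nat -> R) (l : C) (L : R) :
  (forall n, Cmod (u n) <= v n) -> Cseries u l -> is_series v L -> Cmod l <= L.
Proof.
  intros Huv Hu Hv.
  change (Rbar_le (Cmod l) L).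
  apply is_lim_seq_le with (u := fun n => Cmod (@sum_n C_AbelianMonoid u n)) (v := sum_n v).
  - intros n. induction n as [|n IH].
    + rewrite !sum_O. apply Huv.
    + rewrite !sum_Sn. eapply Rle_trans; [apply Cmod_triangle|].
      apply Rplus_le_compat; [apply IH | apply Huv].
  - apply is_lim_seq_ext with (u := fun n => @norm C_AbsRing C_NormedModule (sum_n u n)).
    { reflexivity. }
    apply (filterlim_comp nat _ R (fun n => sum_n u n) (@norm C_AbsRing C_NormedModule)
             eventually (locally l)).
    + exact Hu.
    + apply (@filterlim_norm C_AbsRing C_NormedModule).
  - exact Hv.
Qed.
Lemma ex_Cseries_le (u : nat -> C) (v : nat -> R) :
  (forall n, Cmod (u n) <= v n) -> ex_series v -> exists l : C, Cseries u l.
Proof.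
  intros Huv Hv.
  apply (@ex_series_le C_AbsRing C_CompleteNormedModule u v); [|exact Hv].
  exact Huv.
Qed.

Lemma Cseries_unique (u : nat -> C) (l l' : C) : Cseries u l -> Cseries u l' -> l = l'.
Proof. intros H H'. exact (@filterlim_locally_unique _ C_AbsRing C_NormedModule _ _ _ _ _ H H'). Qed.

Lemma Cseries_terms_lim_0 (u : nat -> C) (l : C) :
  Cseries u l -> is_lim_seq (fun n => Cmod (u n)) 0.
Proof.
  intros H.
  assert (HC : @Cauchy_series C_AbsRing C_CompleteNormedModule u).
  { apply Cauchy_ex_series. now exists l. }
  apply is_lim_seq_spec. intros eps. destruct (HC eps) as [N HN].
  exists N. intros n Hn. specialize (HN n n Hn Hn).
  rewrite sum_n_n in HN. rewrite Rminus_0_r, Rabs_pos_eq by apply Cmod_ge_0.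
  exact HN.
Qed.

(** * Termwise differentiation of complex power series *)

(** Convergence on the whole disk makes |c_n| s^n tend to 0 for every s < 1,
    which forces the real series of moduli to have radius at least 1; the real
    theory of [CV_radius] then provides all majorants, derivatives included. *)
Lemma CV_radius_Cmod (c : nat -> C) (f : C -> C) (r : R) :
  (forall z, unit_disk z -> Cpseries c z (f z)) ->
  0 <= r < 1 -> Rbar_lt (Rabs r) (CV_radius (fun n => Cmod (c n))).
Proof.
  intros Hf Hr.
  set (s := (1 + r) / 2).
  rewrite Rabs_pos_eq by lra.
  apply Rbar_lt_le_trans with s; [unfold s; simpl; lra|].
  apply Rbar_not_lt_le. intros Hlt.
  replace (Finite s) with (Finite (Rabs s)) in Hlt
    by (rewrite Rabs_pos_eq; [reflexivity | unfold s; lra]).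
  apply (CV_disk_outside _ _ Hlt).
  assert (Hs : unit_disk (RtoC s)).
  { unfold unit_disk. rewrite Cmod_R, Rabs_pos_eq; unfold s; lra. }
  apply Hf, Cpseries_Cseries, Cseries_terms_lim_0 in Hs.
  revert Hs. apply is_lim_seq_ext. intros n.
  rewrite Cmod_mult, Cmod_pow, Cmod_R, Rabs_pos_eq; [ring | unfold s; lra].
Qed.

Lemma ex_series_Cmod_PS_derive2 (c : nat -> C) (f : C -> C) (r : R) :
  (forall z, unit_disk z -> Cpseries c z (f z)) -> 0 <= r < 1 ->
  ex_series (fun n => Cmod (c n) * r ^ n) /\
  ex_series (fun n => INR (S n) * Cmod (c (S n)) * r ^ n) /\
  ex_series (fun n => INR (S n) * (INR (S (S n)) * Cmod (c (S (S n)))) * r ^ n).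
Proof.
  intros Hf Hr.
  pose proof (CV_radius_Cmod c f r Hf Hr) as H0.
  pose proof H0 as H1. rewrite <- CV_radius_derive in H1.
  pose proof H1 as H2. rewrite <- CV_radius_derive in H2.
  repeat split; apply ex_pseries_R.
  - exact (CV_radius_inside _ _ H0).
  - exact (CV_radius_inside _ _ H1).
  - exact (CV_radius_inside _ _ H2).
Qed.

Lemma Cmod_pow_diff (z h : C) (r : R) (n : nat) :
  Cmod z <= r -> Cmod (z + h) <= r ->
  Cmod ((z + h) ^ S n - z ^ S n)%C <= Cmod h * (INR (S n) * r ^ n).
Proof.
  intros Hz Hzh. assert (0 <= r) by (eapply Rle_trans; [apply Cmod_ge_0 | exact Hz]).
  induction n as [|n IH].
  - simpl. replace ((z + h) * 1 - z * 1)%C with h by ring. lra.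
  - replace ((z + h) ^ S (S n) - z ^ S (S n))%C
      with ((z + h) * ((z + h) ^ S n - z ^ S n) + h * z ^ S n)%C
      by (rewrite !Cpow_S; ring).
    eapply Rle_trans; [apply Cmod_triangle|].
    rewrite !Cmod_mult, Cmod_pow.
    assert (Hp : Cmod z ^ S n <= r ^ S n).
    { apply pow_incr. split; [apply Cmod_ge_0 | exact Hz]. }
    rewrite (S_INR (S n)).
    replace (Cmod h * ((INR (S n) + 1) * r ^ S n))
      with (r * (Cmod h * (INR (S n) * r ^ n)) + Cmod h * r ^ S n) by (simpl pow; ring).
    apply Rplus_le_compat.
    + apply Rmult_le_compat; try apply Cmod_ge_0; assumption.
    + apply Rmult_le_compat_l; [apply Cmod_ge_0 | exact Hp].
Qed.

(** Induction through E_(n+1) = z E_n + h D_n, where D_n = (z + h)^n - z^n and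
    E_n = D_n - n h z^(n-1). *)
Lemma Cmod_pow_taylor (z h : C) (r : R) (n : nat) :
  Cmod z <= r -> Cmod (z + h) <= r ->
  Cmod ((z + h) ^ S (S n) - z ^ S (S n) - h * (RtoC (INR (S (S n))) * z ^ S n))%C
    <= Cmod h ^ 2 * (INR (S n) * INR (S (S n)) * r ^ n).
Proof.
  intros Hz Hzh. assert (0 <= r) by (eapply Rle_trans; [apply Cmod_ge_0 | exact Hz]).
  induction n as [|n IH].
  - replace ((z + h) ^ 2 - z ^ 2 - h * (RtoC (INR 2) * z ^ 1))%C with (h * h)%C.
    + rewrite Cmod_mult. simpl. pose proof (Cmod_ge_0 h). nra.
    + simpl INR. rewrite RtoC_plus. simpl. ring.
  - replace ((z + h) ^ S (S (S n)) - z ^ S (S (S n)) - h * (RtoC (INR (S (S (S n)))) * z ^ S (S n)))%C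
      with (z * ((z + h) ^ S (S n) - z ^ S (S n) - h * (RtoC (INR (S (S n))) * z ^ S n))
            + h * ((z + h) ^ S (S n) - z ^ S (S n)))%C
      by (rewrite (S_INR (S (S n))), RtoC_plus, !Cpow_S; ring).
    eapply Rle_trans; [apply Cmod_triangle|].
    rewrite !Cmod_mult.
    pose proof (Cmod_pow_diff z h r (S n) Hz Hzh) as HD.
    pose proof (Cmod_ge_0 h) as Hh.
    apply Rle_trans with
      (r * (Cmod h ^ 2 * (INR (S n) * INR (S (S n)) * r ^ n))
       + Cmod h * (Cmod h * (INR (S (S n)) * r ^ S n))).
    + apply Rplus_le_compat.
      * apply Rmult_le_compat; try apply Cmod_ge_0; assumption.
      * apply Rmult_le_compat_l; assumption.
    + rewrite !S_INR. pose proof (pos_INR n).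
      assert (0 <= Cmod h ^ 2 * r ^ S n) by (apply Rmult_le_pos; apply pow_le; assumption).
      simpl pow in *. nra.
Qed.

Definition CPS_derive (c : nat -> C) (n : nat) : C := (RtoC (INR (S n)) * c (S n))%C.

(** The remainder f(z + h) - f(z) - h l is again the sum of a series, whose
    terms are bounded by |h|^2 times the terms of the second derivative of
    the series of moduli at a radius r between |z| and 1. *)
Lemma is_derive_Cpseries (c : nat -> C) (f : C -> C) (z : C) :
  (forall w, unit_disk w -> Cpseries c w (f w)) -> unit_disk z ->
  exists l : C, Cpseries (CPS_derive c) z l /\ @is_derive C_AbsRing C_NormedModule f z l.
Proof.
  intros Hf Hz. unfold unit_disk in Hz.
  pose proof (Cmod_ge_0 z) as Hz0.
  set (r := (1 + Cmod z) / 2).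
  assert (Hr : 0 <= r < 1) by (unfold r; lra).
  destruct (ex_series_Cmod_PS_derive2 c f (Cmod z) Hf (conj Hz0 Hz)) as (_ & H1 & _).
  destruct (ex_series_Cmod_PS_derive2 c f r Hf Hr) as (_ & _ & [K HK]).
  destruct (ex_Cseries_le (fun n => z ^ n * CPS_derive c n)%C
              (fun n => INR (S n) * Cmod (c (S n)) * Cmod z ^ n)) as [l Hl]; [|exact H1|].
  { intros n. unfold CPS_derive.
    rewrite !Cmod_mult, Cmod_pow, Cmod_R, Rabs_pos_eq by apply pos_INR. right; ring. }
  exists l. split; [now apply Cpseries_Cseries|].
  assert (Hquad : forall h : C, Cmod (z + h) <= r ->
             Cmod (f (z + h) - f z - h * l)%C <= Cmod h ^ 2 * K).
  { intros h Hh.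
    assert (Hzr : Cmod z <= r) by (unfold r; lra).
    assert (Hzh : unit_disk (z + h)) by (unfold unit_disk; lra).
    pose proof (proj1 (Cpseries_Cseries _ _ _) (Hf _ Hz)) as S1.
    pose proof (proj1 (Cpseries_Cseries _ _ _) (Hf _ Hzh)) as S2.
    assert (S3 : Cseries (fun n => (z ^ S n * c (S n))%C) (f z - c O)%C).
    { replace (f z - c O)%C with (f z - z ^ O * c O)%C by (simpl; ring).
      exact (Cseries_incr_1 _ _ S1). }
    assert (S4 : Cseries (fun n => ((z + h) ^ S n * c (S n))%C) (f (z + h) - c O)%C).
    { replace (f (z + h) - c O)%C with (f (z + h) - (z + h) ^ O * c O)%C by (simpl; ring).
      exact (Cseries_incr_1 _ _ S2). }
    pose proof (@is_series_scal C_AbsRing C_NormedModule h _ _ Hl) as S5.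
    pose proof (@is_series_minus C_AbsRing C_NormedModule _ _ _ _
      (@is_series_minus C_AbsRing C_NormedModule _ _ _ _ S4 S3) S5) as S6.
    set (w := fun n => (((z + h) ^ S n - z ^ S n - h * (RtoC (INR (S n)) * z ^ n)) * c (S n))%C).
    assert (S7 : Cseries w (f (z + h) - f z - h * l)%C).
    { replace (f (z + h) - f z - h * l)%C with
       ((f (z + h) - c O) + - (f z - c O) + - (h * l))%C by ring.
      revert S6. apply is_series_ext. intros n. unfold w, CPS_derive.
      change ((z + h) ^ S n * c (S n) + - (z ^ S n * c (S n))
        + - (h * (z ^ n * (RtoC (INR (S n)) * c (S n)))) =
        ((z + h) ^ S n - z ^ S n - h * (RtoC (INR (S n)) * z ^ n)) * c (S n))%C. ring. }
    (* The term linear in z has no remainder, so the majorant starts one later. *)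
    assert (W0 : w O = 0%C). { unfold w. simpl. ring. }
    apply (Cmod_Cseries_le (fun n => w (S n)) (fun n => scal (Cmod h ^ 2) (INR (S n) * (INR (S (S n)) * Cmod (c (S (S n)))) * r ^ n))).
    - intros n. unfold w. rewrite Cmod_mult.
      pose proof (Cmod_pow_taylor z h r n Hzr Hh) as HT.
      apply Rle_trans with (Cmod h ^ 2 * (INR (S n) * INR (S (S n)) * r ^ n) * Cmod (c (S (S n)))).
      + apply Rmult_le_compat_r; [apply Cmod_ge_0 | exact HT].
      + right. change scal with Rmult. ring.
    - replace (f (z + h) - f z - h * l)%C with (f (z + h) - f z - h * l - w O)%C by (rewrite W0; ring).
      exact (Cseries_incr_1 _ _ S7).
    - exact (is_series_scal (Cmod h ^ 2) _ _ HK). }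
  split.
  - apply is_linear_scal_l.
  - intros x Hx.
    assert (Ex : x = z).
    { symmetry. exact (@is_filter_lim_locally_unique C_AbsRing (AbsRing_NormedModule C_AbsRing) z x Hx). }
    subst x. intros eps.
    assert (Hd : 0 < Rmin (r - Cmod z) (eps / (Rabs K + 1))).
    { apply Rmin_glb_lt; [unfold r; lra|]. apply Rdiv_lt_0_compat; [apply cond_pos | pose proof (Rabs_pos K); lra]. }
    exists (mkposreal _ Hd). intros y Hy.
    change (Cmod (y - z)%C < Rmin (r - Cmod z) (eps / (Rabs K + 1))) in Hy.
    assert (Hy1 : Cmod (y - z)%C < r - Cmod z) by (eapply Rlt_le_trans; [exact Hy | apply Rmin_l]).
    assert (Hy2 : Cmod (y - z)%C < eps / (Rabs K + 1)) by (eapply Rlt_le_trans; [exact Hy | apply Rmin_r]).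
    change (@norm C_AbsRing C_NormedModule (f y - f z - (y - z) * l)%C <= eps * Cmod (y - z)%C).
    change (Cmod (f y - f z - (y - z) * l)%C <= eps * Cmod (y - z)%C).
    assert (Eyz : forall a b : C, a = (b + (a - b))%C) by (intros; ring).
    rewrite (Eyz y z) at 1.
    eapply Rle_trans; [apply Hquad|].
    + eapply Rle_trans; [apply Cmod_triangle|]. lra.
    + clear Hy Hy1 Hd Eyz. revert Hy2. pose proof (Cmod_ge_0 (y - z)%C) as Hd.
      revert Hd. generalize (Cmod (y - z)%C). intros d Hd0 Hd.
      pose proof (Rle_abs K). pose proof (Rabs_pos K).
      apply (Rmult_lt_compat_r (Rabs K + 1)) in Hd; [|lra].
      unfold Rdiv in Hd. rewrite Rmult_assoc, Rinv_l, Rmult_1_r in Hd by lra.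
      apply Rle_trans with (d * (d * (Rabs K + 1))); nra.
Qed.

Lemma is_derive_Cpseries_C_derive (c : nat -> C) (f : C -> C) (z : C) :
  (forall w, unit_disk w -> Cpseries c w (f w)) -> unit_disk z ->
  Cpseries (CPS_derive c) z (C_derive f z) /\ @ex_derive C_AbsRing C_NormedModule f z.
Proof.
  intros Hf Hz. destruct (is_derive_Cpseries c f z Hf Hz) as (l & Hl & Hd).
  rewrite (is_C_derive_unique f z l Hd). split; [exact Hl | now exists l].
Qed.

(** * Parseval over the roots of unity *)

(** A constant with values in C, not a notation for [sum_n], so that ring and
    field recognize the carrier. *)
Definition Csum (u : nat -> C) (n : nat) : C := @sum_n C_AbelianMonoid u n.

Lemma Csum_O (u : nat -> C) : Csum u 0 = u O.
Proof. exact (sum_O u). Qed.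

Lemma Csum_S (u : nat -> C) (n : nat) : Csum u (S n) = (Csum u n + u (S n))%C.
Proof. exact (sum_Sn u n). Qed.

Lemma Csum_ext (u v : nat -> C) (n : nat) :
  (forall k, u k = v k) -> Csum u n = Csum v n.
Proof. exact (sum_n_ext u v n). Qed.

Lemma Csum_plus (u v : nat -> C) (n : nat) :
  Csum (fun k => u k + v k)%C n = (Csum u n + Csum v n)%C.
Proof. exact (sum_n_plus u v n). Qed.

Definition cis (x : R) : C := (cos x, sin x).

Lemma cis_pow (x : R) (k : nat) : (cis x ^ k)%C = cis (INR k * x).
Proof.
  induction k as [|k IH].
  - unfold cis. simpl. now rewrite Rmult_0_l, cos_0, sin_0.
  - rewrite Cpow_S, IH, S_INR, Rmult_plus_distr_r, Rmult_1_l, Rplus_comm.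
    unfold cis, Cmult. simpl. rewrite cos_plus, sin_plus.
    apply injective_projections; simpl; ring.
Qed.

Lemma Cmod_cis (x : R) : Cmod (cis x) = 1.
Proof.
  unfold Cmod, cis. simpl.
  replace (cos x * (cos x * 1) + sin x * (sin x * 1)) with 1; [apply sqrt_1|].
  pose proof (sin2_cos2 x) as H. unfold Rsqr in H. lra.
Qed.

Definition root1 (n : nat) : C := cis (2 * (PI / INR (S n))).

Lemma root1_pow_order (n : nat) : (root1 n ^ S n)%C = 1%C.
Proof.
  unfold root1. rewrite cis_pow.
  assert (INR (S n) <> 0) by (apply not_0_INR; lia).
  replace (INR (S n) * (2 * (PI / INR (S n)))) with (2 * PI) by (field; assumption).
  unfold cis. now rewrite cos_2PI, sin_2PI.
Qed.

(** Primitivity: cos (2 x) = 1 - 2 (sin x)^2 differs from 1 because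
    x = k PI / (n + 1) lies strictly between 0 and PI. *)
Lemma root1_pow_neq_1 (n k : nat) : (0 < k <= n)%nat -> (root1 n ^ k)%C <> 1%C.
Proof.
  intros Hk. unfold root1. rewrite cis_pow. unfold cis. intros H.
  assert (H1 : cos (INR k * (2 * (PI / INR (S n)))) = 1) by exact (f_equal fst H).
  clear H.
  assert (HN : 0 < INR (S n)) by (apply lt_0_INR; lia).
  set (x := INR k * (PI / INR (S n))).
  replace (INR k * (2 * (PI / INR (S n)))) with (2 * x) in H1 by (unfold x; ring).
  rewrite cos_2a_sin in H1.
  pose proof PI_RGT_0.
  assert (Hx : 0 < PI / INR (S n)) by (now apply Rdiv_lt_0_compat).
  assert (0 < sin x); [|nra].
  apply sin_gt_0; unfold x.
  - apply Rmult_lt_0_compat; [apply lt_0_INR; lia | exact Hx].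
  - apply Rlt_le_trans with (INR (S n) * (PI / INR (S n))).
    + apply Rmult_lt_compat_r; [exact Hx | apply lt_INR; lia].
    + right. field. lra.
Qed.

Lemma Csum_geom (w : C) (n : nat) :
  (Csum (fun j => w ^ j)%C n * (1 - w))%C = (1 - w ^ S n)%C.
Proof.
  induction n as [|n IH].
  - rewrite Csum_O. simpl. ring.
  - rewrite Csum_S, Cmult_plus_distr_r, IH, !Cpow_S. ring.
Qed.

Lemma Csum_geom_root (w : C) (n : nat) :
  (w ^ S n)%C = 1%C -> w <> 1%C -> Csum (fun j => w ^ j)%C n = 0%C.
Proof.
  intros H1 H2. pose proof (Csum_geom w n) as H. rewrite H1 in H.
  assert (H3 : (1 - w)%C <> 0%C).
  { intros E. apply H2. replace w with (1 - (1 - w))%C by ring. rewrite E. ring. }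
  replace (Csum _ n) with (Csum (fun j => w ^ j)%C n * (1 - w) / (1 - w))%C
    by (field; exact H3).
  rewrite H. field. exact H3.
Qed.

Lemma Csum_mult_l (c : C) (u : nat -> C) (n : nat) :
  Csum (fun j => c * u j)%C n = (c * Csum u n)%C.
Proof. exact (@sum_n_mult_l C_Ring c u n). Qed.

Definition circle_pt (r : R) (n j : nat) : C := (RtoC r * root1 n ^ j)%C.

Lemma Cmod_circle_pt (r : R) (n j : nat) : 0 <= r -> Cmod (circle_pt r n j) = r.
Proof.
  intros Hr. unfold circle_pt, root1.
  rewrite Cmod_mult, Cmod_pow, Cmod_cis, pow1, Cmod_R, Rabs_pos_eq; lra.
Qed.

(** Since the conjugate of a point of modulus r is r^2 over that point, the
    summand is a constant times the j-th power of conj(root1 n)^(p - k), a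
    nontrivial root of unity. *)
Lemma circle_pt_orthogonal (r : R) (n k p : nat) :
  (k < p <= n)%nat -> 0 <= r ->
  Csum (fun j => circle_pt r n j ^ k * Cconj (circle_pt r n j ^ p))%C n = 0%C.
Proof.
  intros Hk Hr. set (m := (p - k)%nat).
  set (w := (Cconj (root1 n) ^ m)%C).
  rewrite (Csum_ext _
             (fun j => (RtoC ((r ^ 2) ^ k * r ^ m) * w ^ j)%C)).
  - rewrite Csum_mult_l, Csum_geom_root; [ring| |].
    + unfold w. rewrite <- Cpow_mult_r, Nat.mul_comm, Cpow_mult_r, <- Cpow_conj, root1_pow_order.
      replace (Cconj 1) with (RtoC 1) by (unfold Cconj, RtoC; simpl; f_equal; ring).
      apply Cpow_1_l.
    + unfold w. rewrite <- Cpow_conj. intros E.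
      apply (f_equal Cconj) in E. rewrite Cconj_conj in E.
      apply (root1_pow_neq_1 n m); [unfold m; lia|].
      rewrite E. unfold Cconj, RtoC. simpl. f_equal. ring.
  - intros j. replace p with (k + m)%nat by (unfold m; lia).
    rewrite Cpow_conj, Cpow_add_r, Cmult_assoc, <- Cpow_mult_l, <- Cmod2_conj, Cmod_circle_pt by exact Hr.
    unfold circle_pt, w. rewrite Cmult_conj, Cpow_conj, Cpow_mult_l.
    rewrite RtoC_mult, !RtoC_pow. rewrite <- !Cpow_mult_r, (Nat.mul_comm j m).
    replace (Cconj r) with (RtoC r) by (unfold Cconj, RtoC; simpl; f_equal; ring).
    ring.
Qed.

Definition Cpoly (b : nat -> C) (n : nat) (z : C) : C := Csum (fun k => z ^ k * b k)%C n.

Lemma Cpoly_orthogonal (b : nat -> C) (r : R) (n m p : nat) :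
  (m < p <= n)%nat -> 0 <= r ->
  Csum (fun j => Cpoly b m (circle_pt r n j) * Cconj (circle_pt r n j ^ p))%C n = 0%C.
Proof.
  intros Hm Hr.
  assert (Hmono : forall k, (k < p)%nat ->
    Csum (fun j => (circle_pt r n j ^ k * b k) * Cconj (circle_pt r n j ^ p))%C n = 0%C).
  { intros k Hk.
    rewrite (Csum_ext _
      (fun j => (b k * (circle_pt r n j ^ k * Cconj (circle_pt r n j ^ p)))%C))
      by (intros j; ring).
    rewrite Csum_mult_l, circle_pt_orthogonal by (lia || assumption). ring. }
  induction m as [|m IH].
  - rewrite <- (Hmono O) by lia. apply Csum_ext. intros j.
    unfold Cpoly. now rewrite Csum_O.
  - rewrite (Csum_ext _
      (fun j => Cpoly b m (circle_pt r n j) * Cconj (circle_pt r n j ^ p)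
                + (circle_pt r n j ^ S m * b (S m)) * Cconj (circle_pt r n j ^ p))%C).
    + rewrite Csum_plus, IH, Hmono by lia. ring.
    + intros j. unfold Cpoly. rewrite Csum_S. ring.
Qed.

Lemma Cmod2_plus (u v : C) :
  Cmod (u + v) ^ 2 = Cmod u ^ 2 + Cmod v ^ 2 + 2 * Re (u * Cconj v).
Proof. rewrite !Cmod2_alt. destruct u, v. unfold Re, Im. simpl. ring. Qed.

Lemma Re_Csum (u : nat -> C) (n : nat) : Re (Csum u n) = sum_n (fun j => Re (u j)) n.
Proof.
  induction n as [|n IH].
  - now rewrite Csum_O, sum_O.
  - rewrite Csum_S, sum_Sn, <- IH. reflexivity.
Qed.

(** The order n + 1 of the root of unity exceeds the degree m, so distinct
    monomials are orthogonal on the sample points and Parseval is exact. *)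
Lemma discrete_parseval (b : nat -> C) (r : R) (n m : nat) :
  (m <= n)%nat -> 0 <= r ->
  INR (S n) * sum_n (fun k => Cmod (b k) ^ 2 * r ^ (2 * k)) m
  = sum_n (fun j => Cmod (Cpoly b m (circle_pt r n j)) ^ 2) n.
Proof.
  intros Hm Hr. induction m as [|m IH].
  - rewrite (@sum_n_ext R_AbelianMonoid
      (fun j => Cmod (Cpoly b 0 (circle_pt r n j)) ^ 2) (fun _ => Cmod (b O) ^ 2)).
    + rewrite sum_n_const, sum_O. simpl. ring.
    + intros j. unfold Cpoly. rewrite Csum_O. f_equal. f_equal. simpl. ring.
  - assert (Hcross : sum_n (fun j => 2 * Re (Cpoly b m (circle_pt r n j)
                       * Cconj (circle_pt r n j ^ S m * b (S m)))) n = 0 :> R).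
    { rewrite (@sum_n_mult_l R_Ring 2), <- Re_Csum.
      rewrite (Csum_ext _
        (fun j => (Cconj (b (S m)) * (Cpoly b m (circle_pt r n j) * Cconj (circle_pt r n j ^ S m)))%C))
        by (intros j; rewrite Cmult_conj; ring).
      rewrite Csum_mult_l, Cpoly_orthogonal by (lia || assumption).
      rewrite Cmult_0_r. change (2 * 0 = 0). ring. }
    rewrite (@sum_n_ext R_AbelianMonoid (fun j => Cmod (Cpoly b (S m) (circle_pt r n j)) ^ 2)
      (fun j => plus (plus (Cmod (Cpoly b m (circle_pt r n j)) ^ 2) (Cmod (b (S m)) ^ 2 * r ^ (2 * S m)))
          (2 * Re (Cpoly b m (circle_pt r n j) * Cconj (circle_pt r n j ^ S m * b (S m)))))).
    + rewrite !sum_n_plus, Hcross, <- IH, sum_n_const, sum_Sn by lia.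
      change plus with Rplus. ring.
    + intros j. change plus with Rplus.
      match goal with |- _ ?x ?y => change (x = y :> R) end.
      replace (Cpoly b (S m) (circle_pt r n j))
        with (Cpoly b m (circle_pt r n j) + circle_pt r n j ^ S m * b (S m))%C
        by (unfold Cpoly; now rewrite Csum_S).
      rewrite Cmod2_plus, (Cmod_mult (_ ^ _)), Cmod_pow, Cmod_circle_pt by exact Hr.
      rewrite pow_mult, Rpow_mult_distr, <- !pow_mult, (Nat.mul_comm 2). ring.
Qed.

(** * Domination of Taylor coefficients *)

Lemma Cmod_Cpoly_le (b : nat -> C) (n : nat) (z : C) :
  Cmod (Cpoly b n z) <= sum_n (fun k => Cmod (b k) * Cmod z ^ k) n.
Proof.
  assert (Ht : forall k, Cmod (z ^ k * b k) = Cmod (b k) * Cmod z ^ k).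
  { intros k. rewrite Cmod_mult, Cmod_pow. ring. }
  unfold Cpoly. induction n as [|n IH].
  - rewrite Csum_O, sum_O, Ht. apply Rle_refl.
  - rewrite Csum_S, sum_Sn. eapply Rle_trans; [apply Cmod_triangle|].
    rewrite Ht. apply Rplus_le_compat_r, IH.
Qed.

(** Uniformity over the circle matters here: the sample points at which the
    partial sum of index n is evaluated depend on n. *)
Lemma Cpoly_uniform_approx (b : nat -> C) (G : C -> C) (r : R) :
  (forall z, unit_disk z -> Cpseries b z (G z)) -> 0 <= r < 1 ->
  exists (M : R) (tau : nat -> R),
    0 <= M /\ is_lim_seq tau 0 /\
    forall n z, Cmod z = r ->
      Cmod (Cpoly b n z) <= M /\ Cmod (G z - Cpoly b n z)%C <= tau n.
Proof.
  intros HG Hr.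
  destruct (ex_series_Cmod_PS_derive2 b G r HG Hr) as [[M HM] _].
  set (v := fun k => Cmod (b k) * r ^ k) in *.
  assert (Hv : forall k, 0 <= v k).
  { intros k. unfold v. apply Rmult_le_pos; [apply Cmod_ge_0 | apply pow_le; lra]. }
  assert (Hle : forall n, sum_n v n <= M).
  { intros n. apply (is_lim_seq_incr_compare (sum_n v) M HM). intros k.
    rewrite sum_Sn. change plus with Rplus. specialize (Hv (S k)). lra. }
  exists M, (fun n => M - sum_n v n). split; [|split].
  - eapply Rle_trans; [|apply (Hle O)]. rewrite sum_O. apply Hv.
  - replace (Finite 0) with (Finite (M - M)) by (f_equal; ring).
    apply (is_lim_seq_minus' (fun _ => M) (sum_n v)); [apply is_lim_seq_const | exact HM].
  - intros n z Hz. split.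
    + eapply Rle_trans; [apply Cmod_Cpoly_le|]. rewrite Hz. apply Hle.
    + assert (Hd : unit_disk z) by (unfold unit_disk; lra).
      pose proof (proj1 (Cpseries_Cseries _ _ _) (HG z Hd)) as S1.
      apply (Cmod_Cseries_le (fun k => (z ^ (S n + k) * b (S n + k)%nat)%C) (fun k => v (S n + k)%nat)).
      * intros k. rewrite Cmod_mult, Cmod_pow, Hz. right. unfold v. ring.
      * apply (@is_series_incr_n C_AbsRing C_NormedModule (fun k => (z ^ k * b k)%C) (S n)); [lia|].
        change (Cseries (fun k => (z ^ k * b k)%C) (G z - Cpoly b n z + Cpoly b n z)%C).
        replace (G z - Cpoly b n z + Cpoly b n z)%C with (G z) by ring. exact S1.
      * apply (@is_series_incr_n R_AbsRing R_NormedModule v (S n)); [lia|].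
        change (is_series v ((M - sum_n v n) + sum_n v n)).
        rewrite Rplus_comm, Rplus_minus. exact HM.
Qed.

Lemma sum_n_le_R (u v : nat -> R) (n : nat) :
  (forall k, (k <= n)%nat -> u k <= v k) -> sum_n u n <= sum_n v n.
Proof.
  intros H. induction n as [|n IH].
  - rewrite !sum_O. now apply H.
  - rewrite !sum_Sn. apply Rplus_le_compat; [apply IH; intros; apply H; lia | apply H; lia].
Qed.

Lemma sum_n_nonneg_mono (u : nat -> R) (n m : nat) :
  (forall k, 0 <= u k) -> (n <= m)%nat -> sum_n u n <= sum_n u m.
Proof.
  intros H Hnm. induction Hnm as [|m Hnm IH]; [apply Rle_refl|].
  rewrite sum_Sn. change plus with Rplus. specialize (H (S m)). lra.
Qed.

(** At the sample points the moduli of the partial sums of G exceed those of H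
    by at most eta, which tends to 0 with the order of the partial sums;
    discrete Parseval converts this pointwise bound into one for the
    coefficients. *)
Lemma coeff_dominated_on_circle (b d : nat -> C) (G H : C -> C) (D r : R) (n : nat) :
  (forall z, unit_disk z -> Cpseries b z (G z)) ->
  (forall z, unit_disk z -> Cpseries d z (H z)) ->
  (forall z, unit_disk z -> Cmod (G z) <= Cmod (H z)) ->
  (forall n, sum_n (fun k => Cmod (d k) ^ 2) n <= D) ->
  0 <= r < 1 -> sum_n (fun k => Cmod (b k) ^ 2 * r ^ (2 * k)) n <= D.
Proof.
  intros HG HH HGH HD Hr.
  destruct (Cpoly_uniform_approx b G r HG Hr) as (Mb & tb & _ & Htb & Hb).
  destruct (Cpoly_uniform_approx d H r HH Hr) as (M & td & HM & Htd & Hd).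
  set (eta := fun N => tb N + td N).
  assert (Heta : is_lim_seq eta 0).
  { replace (Finite 0) with (Finite (0 + 0)) by (f_equal; ring).
    now apply is_lim_seq_plus'. }
  change (Rbar_le (sum_n (fun k => Cmod (b k) ^ 2 * r ^ (2 * k)) n) D).
  apply is_lim_seq_le_loc with
    (u := fun _ => sum_n (fun k => Cmod (b k) ^ 2 * r ^ (2 * k)) n)
    (* |F_d + eta|^2 <= |F_d|^2 + 2 M eta + eta^2, where M bounds |F_d|. *)
    (v := fun N => D + (2 * M * eta N + eta N * eta N)).
  - exists n. intros N HN.
    assert (HNpos : 0 < INR (S N)) by (apply lt_0_INR; lia).
    apply Rmult_le_reg_l with (INR (S N)); [exact HNpos|].
    apply Rle_trans with (INR (S N) * sum_n (fun k => Cmod (b k) ^ 2 * r ^ (2 * k)) N).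
    { apply Rmult_le_compat_l; [lra|]. apply sum_n_nonneg_mono; [|exact HN].
      intros k. apply Rmult_le_pos; [apply pow2_ge_0 | apply pow_le; lra]. }
    rewrite discrete_parseval by (lia || lra).
    apply Rle_trans with (sum_n (fun j => Cmod (Cpoly d N (circle_pt r N j)) ^ 2
                             + (2 * M * eta N + eta N * eta N)) N).
    { apply sum_n_le_R. intros j _.
      set (z := circle_pt r N j).
      assert (Hz : Cmod z = r) by (apply Cmod_circle_pt; lra).
      destruct (Hb N z Hz) as [_ Hb2]. destruct (Hd N z Hz) as [Hd1 Hd2].
      assert (Hgh : Cmod (G z) <= Cmod (H z)) by (apply HGH; unfold unit_disk; lra).
      assert (T1 : Cmod (Cpoly b N z) <= Cmod (G z) + tb N).
      { replace (Cpoly b N z) with (G z + - (G z - Cpoly b N z))%C by ring.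
        eapply Rle_trans; [apply Cmod_triangle|]. rewrite Cmod_opp. lra. }
      assert (T2 : Cmod (H z) <= Cmod (Cpoly d N z) + td N).
      { replace (H z) with (Cpoly d N z + (H z - Cpoly d N z))%C by ring.
        eapply Rle_trans; [apply Cmod_triangle|]. lra. }
      pose proof (Cmod_ge_0 (Cpoly b N z)). pose proof (Cmod_ge_0 (Cpoly d N z)).
      pose proof (Cmod_ge_0 (G z - Cpoly b N z)). pose proof (Cmod_ge_0 (H z - Cpoly d N z)).
      assert (0 <= eta N) by (unfold eta; lra).
      assert (T : Cmod (Cpoly b N z) <= Cmod (Cpoly d N z) + eta N) by (unfold eta; lra).
      apply Rle_trans with ((Cmod (Cpoly d N z) + eta N) ^ 2).
      - apply pow_incr. split; assumption.
      - nra. }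
    rewrite (@sum_n_plus R_AbelianMonoid), sum_n_const.
    rewrite <- (discrete_parseval d) by (lia || lra). change plus with Rplus.
    rewrite <- Rmult_plus_distr_l. apply Rmult_le_compat_l; [lra|].
    apply Rplus_le_compat_r. eapply Rle_trans; [|apply (HD N)].
    apply sum_n_le_R. intros k _.
    rewrite <- (Rmult_1_r (Cmod (d k) ^ 2)) at 2.
    apply Rmult_le_compat_l; [apply pow2_ge_0|].
    rewrite <- (pow1 (2 * k)). apply pow_incr. lra.
  - apply is_lim_seq_const.
  - replace (Finite D) with (Finite (D + (2 * M * 0 + 0 * 0))) by (f_equal; ring).
    apply is_lim_seq_plus'; [apply is_lim_seq_const|].
    apply is_lim_seq_plus'.
    + apply (is_lim_seq_mult' (fun _ => 2 * M)); [apply is_lim_seq_const | exact Heta].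
    + now apply is_lim_seq_mult'.
Qed.

(** Monotonicity of the norm of the Hardy space H^2, in terms of coefficients:
    let r tend to 1 in the bound on the circle of radius r. *)
Lemma coeff_dominated (b d : nat -> C) (G H : C -> C) (D : R) (n : nat) :
  (forall z, unit_disk z -> Cpseries b z (G z)) ->
  (forall z, unit_disk z -> Cpseries d z (H z)) ->
  (forall z, unit_disk z -> Cmod (G z) <= Cmod (H z)) ->
  (forall n, sum_n (fun k => Cmod (d k) ^ 2) n <= D) ->
  sum_n (fun k => Cmod (b k) ^ 2) n <= D.
Proof.
  intros HG HH HGH HD.
  set (r := fun j => 1 - / (INR j + 1)).
  assert (Hinv : forall j, 0 < / (INR j + 1) <= 1).
  { intros j. pose proof (pos_INR j). split; [apply Rinv_0_lt_compat; lra|].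
    rewrite <- Rinv_1. apply Rinv_le_contravar; lra. }
  assert (Hlim : is_lim_seq r 1).
  { replace (Finite 1) with (Finite (1 - 0)) by (f_equal; ring).
    apply (is_lim_seq_minus' (fun _ => 1)); [apply is_lim_seq_const|].
    replace (Finite 0) with (Rbar_inv p_infty) by reflexivity.
    apply is_lim_seq_inv; [|easy].
    apply is_lim_seq_ext with (fun j => INR (S j)); [intros j; apply S_INR|].
    apply (is_lim_seq_incr_1 INR), is_lim_seq_INR. }
  assert (Hpow : forall m, is_lim_seq (fun j => r j ^ m) 1).
  { induction m as [|m IH]; [apply is_lim_seq_const|].
    replace (Finite 1) with (Finite (1 * 1)) by (f_equal; ring).
    now apply (is_lim_seq_mult' r). }
  change (Rbar_le (sum_n (fun k => Cmod (b k) ^ 2) n) D).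
  apply is_lim_seq_le with
    (u := fun j => sum_n (fun k => Cmod (b k) ^ 2 * r j ^ (2 * k)) n) (v := fun _ => D).
  - intros j. apply (coeff_dominated_on_circle b d G H); try assumption. specialize (Hinv j). unfold r. lra.
  - assert (Ht : forall k, is_lim_seq (fun j => Cmod (b k) ^ 2 * r j ^ (2 * k)) (Cmod (b k) ^ 2)).
    { intros k. replace (Finite (Cmod (b k) ^ 2)) with (Finite (Cmod (b k) ^ 2 * 1)) by (f_equal; ring).
      apply (is_lim_seq_mult' (fun _ => _)); [apply is_lim_seq_const | apply Hpow]. }
    induction n as [|m IH].
    + rewrite sum_O. apply is_lim_seq_ext with (2 := Ht O). intros j. now rewrite sum_O.
    + rewrite sum_Sn.
      apply is_lim_seq_ext with
        (fun j => sum_n (fun k => Cmod (b k) ^ 2 * r j ^ (2 * k)) m + Cmod (b (S m)) ^ 2 * r j ^ (2 * S m)).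
      * intros j. now rewrite sum_Sn.
      * now apply is_lim_seq_plus'.
  - apply is_lim_seq_const.
Qed.

(** The vector on the left is the product of (x0, x1, x2) with the lower
    triangular Toeplitz matrix with first column (a0, a1, a2), that is, the
    first three coefficients of (a0 + a1 z + a2 z^2) (x0 + x1 z + x2 z^2). *)
Definition toeplitz3_contraction (a0 a1 a2 : C) : Prop := forall x0 x1 x2 : C,
  Cmod (x0 * a0) ^ 2 + Cmod (x0 * a1 + x1 * a0) ^ 2 + Cmod (x0 * a2 + x1 * a1 + x2 * a0) ^ 2
  <= Cmod x0 ^ 2 + Cmod x1 ^ 2 + Cmod x2 ^ 2.

Definition quadratic_mul_coeff (x0 x1 x2 : C) (a : nat -> C) (k : nat) : C :=
  match k with
  | O => (x0 * a O)%C
  | S O => (x0 * a 1%nat + x1 * a O)%C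
  | S (S m) => (x0 * a (S (S m)) + x1 * a (S m) + x2 * a m)%C
  end.

Lemma Cpseries_quadratic_mul (x0 x1 x2 : C) (a : nat -> C) (z l : C) :
  Cpseries a z l ->
  Cpseries (quadratic_mul_coeff x0 x1 x2 a) z ((x0 + x1 * z + x2 * z ^ 2) * l)%C.
Proof.
  intros H.
  assert (Hs : forall x, Cpseries (PS_scal x a) z (x * l)%C).
  { intros x. apply (@is_pseries_scal C_AbsRing C_NormedModule x a z l); [apply Cmult_comm | exact H]. }
  pose proof (@is_pseries_incr_1 C_AbsRing C_NormedModule _ _ _ (Hs x1)) as H1.
  pose proof (@is_pseries_incr_1 C_AbsRing C_NormedModule _ _ _
    (@is_pseries_incr_1 C_AbsRing C_NormedModule _ _ _ (Hs x2))) as H2.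
  pose proof (@is_pseries_plus C_AbsRing C_NormedModule _ _ _ _ _
    (@is_pseries_plus C_AbsRing C_NormedModule _ _ _ _ _ (Hs x0) H1) H2) as H3.
  replace ((x0 + x1 * z + x2 * z ^ 2) * l)%C
    with ((x0 * l + z * (x1 * l)) + z * (z * (x2 * l)))%C by ring.
  revert H3. apply is_pseries_ext. intros [|[|m]].
  - change (x0 * a O + 0 + 0 = x0 * a O)%C. ring.
  - change (x0 * a 1%nat + x1 * a O + 0 = x0 * a 1%nat + x1 * a O)%C. ring.
  - reflexivity.
Qed.

Definition one_coeff (k : nat) : C := match k with O => 1%C | S _ => 0%C end.

Lemma Cpseries_one (z : C) : Cpseries one_coeff z (RtoC 1).
Proof.
  apply Cpseries_Cseries.
  assert (H : forall n, RtoC 1 = Csum (fun k => z ^ k * one_coeff k)%C n).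
  { induction n as [|n IH].
    - rewrite Csum_O. simpl. ring.
    - rewrite Csum_S, <- IH. simpl. ring. }
  apply (filterlim_ext (fun _ => RtoC 1)); [exact H | apply filterlim_const].
Qed.

(** Domination applied to G = g H with H = x0 + x1 z + x2 z^2, whose
    coefficients have square norm |x0|^2 + |x1|^2 + |x2|^2. *)
Lemma toeplitz3_contraction_of_bounded (a : nat -> C) (g : C -> C) :
  (forall z, unit_disk z -> Cpseries a z (g z)) ->
  (forall z, unit_disk z -> Cmod (g z) <= 1) ->
  toeplitz3_contraction (a 0%nat) (a 1%nat) (a 2%nat).
Proof.
  intros Ha Hg x0 x1 x2.
  assert (H := coeff_dominated
    (quadratic_mul_coeff x0 x1 x2 a) (quadratic_mul_coeff x0 x1 x2 one_coeff)
    (fun z => (x0 + x1 * z + x2 * z ^ 2) * g z)%C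
    (fun z => (x0 + x1 * z + x2 * z ^ 2) * 1)%C
    (Cmod x0 ^ 2 + Cmod x1 ^ 2 + Cmod x2 ^ 2) 2).
  rewrite !sum_Sn, sum_O in H. change plus with Rplus in H. apply H; clear H.
  - intros z Hz. now apply Cpseries_quadratic_mul, Ha.
  - intros z _. apply Cpseries_quadratic_mul, Cpseries_one.
  - intros z Hz. rewrite !Cmod_mult, Cmod_1.
    apply Rmult_le_compat_l; [apply Cmod_ge_0 | now apply Hg].
  - assert (E0 : quadratic_mul_coeff x0 x1 x2 one_coeff 0 = x0) by (simpl; ring).
    assert (E1 : quadratic_mul_coeff x0 x1 x2 one_coeff 1 = x1) by (simpl; ring).
    assert (E2 : quadratic_mul_coeff x0 x1 x2 one_coeff 2 = x2) by (simpl; ring).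
    assert (E3 : forall n, quadratic_mul_coeff x0 x1 x2 one_coeff (S (S (S n))) = 0%C)
      by (intros n; simpl; ring).
    pose proof (pow2_ge_0 (Cmod x1)). pose proof (pow2_ge_0 (Cmod x2)).
    intros [|[|n]].
    + rewrite sum_O, E0. lra.
    + rewrite sum_Sn, sum_O, E0, E1. change plus with Rplus. lra.
    + induction n as [|n IH].
      * rewrite !sum_Sn, sum_O, E0, E1, E2. apply Rle_refl.
      * rewrite sum_Sn, E3, Cmod_0. change plus with Rplus. lra.
Qed.

(** * Schur's inequalities for a contractive Toeplitz matrix *)

(** In the direction x = - s conj(B) the form is a real quadratic polynomial
    in s, minimal at s = 1 / A. *)
Lemma quadratic_form_discriminant (A D : R) (B : C) :
  (forall x : C, 0 <= A * Cmod x ^ 2 + 2 * Re (B * x) + D) -> Cmod B ^ 2 <= A * D.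
Proof.
  intros Hx.
  assert (HD : 0 <= D).
  { specialize (Hx 0%C). rewrite Cmult_0_r, Cmod_0 in Hx. simpl in Hx. lra. }
  destruct (Ceq_dec B 0) as [HB0 | HB0].
  - subst B. rewrite Cmod_0. replace (0 ^ 2) with 0 by ring.
    apply Rmult_le_pos; [|exact HD]. apply Rnot_lt_le. intros HA.
    specialize (Hx (RtoC (D / (- A) + 1))).
    assert (Ht : 0 <= D / (- A)) by (apply Rdiv_le_0_compat; lra).
    rewrite Cmult_0_l, Cmod_R, pow2_abs in Hx. simpl Re in Hx.
    assert (Hd : D = - A * (D / - A)) by (field; lra).
    rewrite Hd in Hx at 2. revert Hx Ht. generalize (D / - A). intros u Hx Hu. nra.
  - assert (HB : 0 < Cmod B ^ 2) by (apply pow_lt, Cmod_gt_0; exact HB0).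
    assert (Hl : forall s : R, 0 <= A * (s ^ 2 * Cmod B ^ 2) - 2 * (s * Cmod B ^ 2) + D).
    { intros s. specialize (Hx (RtoC (- s) * Cconj B)%C).
      rewrite Cmod_mult, Cmod_R, Cmod_conj, Rpow_mult_distr, pow2_abs in Hx.
      replace (Re (B * (RtoC (- s) * Cconj B))) with (- (s * Cmod B ^ 2)) in Hx.
      - replace ((- s) ^ 2) with (s ^ 2) in Hx by ring. lra.
      - rewrite Cmod2_alt. destruct B. unfold Re, Im. simpl. ring. }
    clear Hx. revert HB Hl. generalize (Cmod B ^ 2). intros beta HB Hl.
    assert (HA : 0 < A).
    { apply Rnot_le_lt. intros HA. specialize (Hl ((D + 1) / (2 * beta))).
      replace (2 * ((D + 1) / (2 * beta) * beta)) with (D + 1) in Hl by (field; lra).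
      pose proof (pow2_ge_0 ((D + 1) / (2 * beta))).
      assert (0 <= ((D + 1) / (2 * beta)) ^ 2 * beta) by (apply Rmult_le_pos; lra).
      nra. }
    specialize (Hl (/ A)).
    replace (A * ((/ A) ^ 2 * beta) - 2 * (/ A * beta) + D) with (D - beta / A) in Hl
      by (field; lra).
    apply (Rmult_le_compat_l A) in Hl; [|lra].
    replace (A * (D - beta / A)) with (A * D - beta) in Hl by (field; lra). lra.
Qed.

Lemma Cmod2_plus_mul (u v x : C) :
  Cmod (u + x * v) ^ 2 = Cmod u ^ 2 + Cmod v ^ 2 * Cmod x ^ 2 + 2 * Re (Cconj u * v * x).
Proof. rewrite !Cmod2_alt. destruct u, v, x. unfold Re, Im. simpl. ring. Qed.

(** The last coordinate of the test vector occurs only through s + x a0; its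
    elimination gives |s|^2 <= q t.  Applied to the vectors (0, 1, x) it yields
    |a1| <= q, and applied to (1, x, w) it leaves a nonnegative form in x.
    The discriminant inequality of this form is the square of the last
    conclusion: the real parts coming from the cross terms agree. *)
Lemma toeplitz3_schur (a0 a1 a2 : C) :
  toeplitz3_contraction a0 a1 a2 ->
  let q := 1 - Cmod a0 ^ 2 in
  0 <= q /\ Cmod a1 ^ 2 <= q ^ 2 /\ Cmod a2 ^ 2 <= q ^ 2 /\
  Cmod (RtoC q * a2 + Cconj a0 * a1 ^ 2) <= q ^ 2 - Cmod a1 ^ 2.
Proof.
  intros HT q.
  assert (Hq : 0 <= q).
  { specialize (HT 0%C 0%C 1%C). rewrite !Cmult_0_l, !Cplus_0_l, Cmult_1_l, Cmod_0, Cmod_1 in HT.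
    unfold q. lra. }
  assert (Hlast : forall (s : C) (t : R),
    (forall x : C, Cmod (s + x * a0) ^ 2 <= t + Cmod x ^ 2) -> Cmod s ^ 2 <= q * t).
  { intros s t Hs.
    (* Solving this for |s|^2 uses |a0|^2 = 1 - q. *)
    assert (Hd : Cmod (- (Cconj s * a0)) ^ 2 <= q * (t - Cmod s ^ 2)).
    { apply quadratic_form_discriminant. intros x. specialize (Hs x).
      rewrite Cmod2_plus_mul in Hs. unfold q.
      replace (Re (- (Cconj s * a0) * x)) with (- Re (Cconj s * a0 * x))
        by (unfold Re; simpl; ring).
      lra. }
    rewrite Cmod_opp, Cmod_mult, Cmod_conj, Rpow_mult_distr in Hd. unfold q in *. nra. }
  assert (H1 : Cmod a1 ^ 2 <= q * q).
  { apply Hlast. intros x. specialize (HT 0%C 1%C x).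
    rewrite !Cmult_0_l, !Cplus_0_l, !Cmult_1_l, Cmod_0, Cmod_1 in HT. unfold q. lra. }
  set (y := Cmod a1 ^ 2) in *.
  assert (H2 : forall x : C, 0 <= (q ^ 2 - y) * Cmod x ^ 2
      + 2 * Re (- (RtoC q * (Cconj a1 * a0) + Cconj a2 * a1) * x) + (q ^ 2 - q * y - Cmod a2 ^ 2)).
  { intros x.
    assert (H2 : Cmod (a2 + x * a1) ^ 2 <= q * (q + Cmod x ^ 2 - Cmod (a1 + x * a0) ^ 2)).
    { apply Hlast. intros w. specialize (HT 1%C x w).
      rewrite !Cmult_1_l, Cmod_1 in HT. unfold q. lra. }
    rewrite !Cmod2_plus_mul in H2. fold y in H2.
    replace (Re (- (RtoC q * (Cconj a1 * a0) + Cconj a2 * a1) * x))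
      with (- (q * Re (Cconj a1 * a0 * x) + Re (Cconj a2 * a1 * x)))
      by (unfold Re; simpl; ring).
    replace (Cmod a0 ^ 2) with (1 - q) in H2 by (unfold q; ring). nra. }
  assert (H3 := H2 0%C). rewrite Cmult_0_r, Cmod_0 in H3. simpl Re in H3.
  apply quadratic_form_discriminant in H2. rewrite Cmod_opp in H2.
  assert (Hy : 0 <= y) by apply pow2_ge_0.
  repeat split; [exact Hq | nra | nra |].
  assert (Hexp : Cmod (RtoC q * a2 + Cconj a0 * a1 ^ 2) ^ 2 - Cmod (RtoC q * (Cconj a1 * a0) + Cconj a2 * a1) ^ 2
     = q ^ 2 * Cmod a2 ^ 2 + (1 - q) * y ^ 2 - (q ^ 2 * (y * (1 - q)) + Cmod a2 ^ 2 * y)).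
  { replace (1 - q) with (Cmod a0 ^ 2) by (unfold q; ring). unfold y. clear.
    rewrite !Cmod2_alt. destruct a0, a1, a2. unfold Re, Im. simpl. ring. }
  apply Rsqr_incr_0_var; [|nra]. unfold Rsqr. nra.
Qed.

(** When q > 0 the identity below reduces the bound to Schur's inequalities;
    when q = 0, that is |a0| = 1, they force a1 = a2 = 0. *)
Lemma toeplitz3_hankel_bound (a0 a1 a2 : C) :
  toeplitz3_contraction a0 a1 a2 ->
  Cmod (a0 * a2 / 3 - a1 ^ 2 / 4) <= 1 / 12 * (1 - Cmod a0 ^ 2) * (3 + Cmod a0 ^ 2).
Proof.
  intros HT. destruct (toeplitz3_schur a0 a1 a2 HT) as (Hq & H1 & H2 & H3).
  set (q := 1 - Cmod a0 ^ 2) in *.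
  set (p := Cmod a0) in *.
  assert (Hp : 0 <= p) by apply Cmod_ge_0.
  destruct (Rle_lt_or_eq_dec _ _ Hq) as [Hpos | Hzero].
  - apply Rmult_le_reg_l with q; [exact Hpos|].
    assert (E : (RtoC q * (a0 * a2 / 3 - a1 ^ 2 / 4)
       = (a0 / 3) * (RtoC q * a2 + Cconj a0 * a1 ^ 2)
         + - (RtoC (p ^ 2 / 3 + q / 4) * a1 ^ 2))%C).
    { rewrite RtoC_plus, !RtoC_div by lra. unfold p. rewrite Cmod2_conj. field. }
    rewrite <- (Rabs_pos_eq q) at 1 by lra.
    rewrite <- Cmod_R, <- Cmod_mult, E.
    eapply Rle_trans; [apply Cmod_triangle|].
    rewrite Cmod_opp, !Cmod_mult, Cmod_pow, Cmod_R, Rabs_pos_eq by nra.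
    replace (Cmod (a0 / 3)) with (p / 3).
    2:{ rewrite Cmod_div, Cmod_R, Rabs_pos_eq by (lra || (intros E3; apply RtoC_inj in E3; lra)). reflexivity. }
    revert H1 H3. generalize (Cmod (RtoC q * a2 + Cconj a0 * a1 ^ 2)) (Cmod a1 ^ 2).
    intros w y H1 H3.
    apply Rle_trans with (p / 3 * (q ^ 2 - y) + (p ^ 2 / 3 + q / 4) * y).
    + apply Rplus_le_compat_r, Rmult_le_compat_l; lra.
    + assert (Hp1 : p <= 1) by (unfold q in Hpos; nra).
      (* The slope in |a1|^2 equals (1 - p) (3 - p) / 12. *)
      assert (Hc : 0 <= p ^ 2 / 3 + q / 4 - p / 3) by (unfold q; nra).
      assert (Hm : (p ^ 2 / 3 + q / 4 - p / 3) * y <= (p ^ 2 / 3 + q / 4 - p / 3) * q ^ 2)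
        by (apply Rmult_le_compat_l; assumption).
      apply Rle_trans with (p / 3 * q ^ 2 + (p ^ 2 / 3 + q / 4 - p / 3) * q ^ 2); [lra|].
      right. unfold q. field.
  - rewrite <- Hzero in H1, H2 |- *.
    assert (Hnull : forall a : C, Cmod a ^ 2 <= 0 ^ 2 -> a = 0%C).
    { intros a Ha. apply Cmod_eq_0. pose proof (Cmod_ge_0 a).
      apply Rle_antisym; nra. }
    apply Hnull in H1, H2.
    rewrite H1, H2.
    assert (E0 : (a0 * 0 / 3 - 0 ^ 2 / 4 = 0)%C) by (simpl; field).
    rewrite E0, Cmod_0. lra.
Qed.

(** * The upper bound *)

Lemma B0'_hankel_bound (omega : C -> C) (c : nat -> C) :
  B0' omega -> has_expansion omega c ->
     0 <= Cmod (c 1%nat) <= 1 /\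
     Cmod (c 1%nat * c 3%nat - c 2%nat * c 2%nat)%C
       <= 1 / 12 * (1 - Cmod (c 1%nat) ^ 2) * (3 + Cmod (c 1%nat) ^ 2).
Proof.
  intros (_ & _ & Hb) (_ & Hc).
  assert (HT := toeplitz3_contraction_of_bounded (CPS_derive c) (C_derive omega)
    (fun z Hz => proj1 (is_derive_Cpseries_C_derive c omega z Hc Hz)) Hb).
  unfold CPS_derive in HT.
  assert (E1 : (RtoC (INR 1) * c 1%nat)%C = c 1%nat) by (simpl; ring).
  rewrite E1 in HT.
  split.
  - split; [apply Cmod_ge_0|].
    destruct (toeplitz3_schur _ _ _ HT) as [Hq _].
    pose proof (Cmod_ge_0 (c 1%nat)). nra.
  - apply toeplitz3_hankel_bound in HT.
    assert (E2 : (c 1%nat * (RtoC (INR 3) * c 3%nat) / 3 - (RtoC (INR 2) * c 2%nat) ^ 2 / 4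
                  = c 1%nat * c 3%nat - c 2%nat * c 2%nat)%C).
    { simpl INR. rewrite !RtoC_plus. simpl Cpow. field. }
    rewrite E2 in HT. exact HT.
Qed.

(** * The extremal functions *)

Lemma Cseries_geom (w : C) : Cmod w < 1 -> Cseries (fun n => (w ^ n)%C) (/ (1 - w))%C.
Proof.
  intros Hw. pose proof (Cmod_ge_0 w).
  destruct (ex_Cseries_le (fun n => (w ^ n)%C) (fun n => Cmod w ^ n)) as [l Hl].
  - intros n. rewrite Cmod_pow. apply Rle_refl.
  - apply ex_series_geom. now rewrite Rabs_pos_eq.
  - assert (E : (l - 1)%C = (w * l)%C).
    { apply (Cseries_unique (fun n => (w ^ S n)%C)).
      - exact (Cseries_incr_1 _ _ Hl).
      - exact (@is_series_scal C_AbsRing C_NormedModule w _ _ Hl). }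
    assert (H1 : (1 - w)%C <> 0%C).
    { intros E0. assert (Ew : w = 1%C) by (replace w with (1 - (1 - w))%C by ring; rewrite E0; ring).
      rewrite Ew, Cmod_1 in Hw. lra. }
    replace (/ (1 - w))%C with l; [exact Hl|].
    assert (E2 : (l * (1 - w) = 1)%C) by (replace (l * (1 - w))%C with (l - w * l)%C by ring; rewrite <- E; ring).
    replace l with (l * (1 - w) / (1 - w))%C by (field; exact H1).
    rewrite E2. field. exact H1.
Qed.

(** Taylor coefficients of (z + t) / (1 + t z) = t + (1 - t^2) z / (1 + t z). *)
Definition blaschke_coeff (t : R) (n : nat) : C :=
  match n with O => RtoC t | S m => RtoC ((1 - t ^ 2) * (- t) ^ m) end.

Lemma one_plus_mul_neq_0 (t : R) (z : C) : 0 <= t <= 1 -> unit_disk z -> (1 + t * z)%C <> 0%C.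
Proof.
  intros Ht Hz E. unfold unit_disk in Hz. pose proof (Cmod_ge_0 z).
  assert (E1 : (t * z = - (1))%C) by (replace (t * z)%C with ((1 + t * z) - 1)%C by ring; rewrite E; ring).
  apply (f_equal Cmod) in E1. rewrite Cmod_mult, Cmod_R, Cmod_opp, Cmod_1, Rabs_pos_eq in E1 by lra.
  nra.
Qed.

Lemma Cpseries_blaschke (t : R) (z : C) :
  0 <= t <= 1 -> unit_disk z ->
  Cpseries (blaschke_coeff t) z ((z + t) / (1 + t * z))%C.
Proof.
  intros Ht Hz. apply Cpseries_Cseries.
  pose proof (one_plus_mul_neq_0 t z Ht Hz) as Hne.
  unfold unit_disk in Hz. pose proof (Cmod_ge_0 z).
  assert (Hw : Cmod (RtoC (- t) * z) < 1).
  { rewrite Cmod_mult, Cmod_R, Rabs_Ropp, Rabs_pos_eq by lra. nra. }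
  pose proof (@is_series_scal C_AbsRing C_NormedModule (z * RtoC (1 - t ^ 2))%C _ _ (Cseries_geom _ Hw)) as H1.
  apply (@is_series_decr_1 C_AbsRing C_NormedModule).
  replace (plus _ _) with (z * RtoC (1 - t ^ 2) * / (1 - RtoC (- t) * z))%C.
  - revert H1. apply is_series_ext. intros n.
    change (z * RtoC (1 - t ^ 2) * (RtoC (- t) * z) ^ n
      = z ^ S n * RtoC ((1 - t ^ 2) * (- t) ^ n))%C.
    rewrite Cpow_mult_l, RtoC_mult, (RtoC_pow (- t)), Cpow_S. ring.
  - change (z * RtoC (1 - t ^ 2) * / (1 - RtoC (- t) * z)
      = (z + t) / (1 + t * z) + - (1 * RtoC t))%C.
    rewrite RtoC_opp, RtoC_minus, (RtoC_pow t). simpl Cpow. field.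
    replace (1 - - t * z)%C with (1 + t * z)%C by ring. exact Hne.
Qed.

Lemma Cmod_blaschke_le (t : R) (z : C) :
  0 <= t <= 1 -> unit_disk z -> Cmod ((z + t) / (1 + t * z))%C <= 1.
Proof.
  intros Ht Hz. pose proof (one_plus_mul_neq_0 t z Ht Hz) as Hne.
  unfold unit_disk in Hz. pose proof (Cmod_ge_0 z).
  rewrite Cmod_div by exact Hne.
  apply Cmod_gt_0 in Hne as Hpos.
  apply Rle_div_l; [exact Hpos|]. rewrite Rmult_1_l.
  apply Rsqr_incr_0_var; [|lra].
  assert (E : Cmod (1 + t * z) ^ 2 - Cmod (z + t) ^ 2 = (1 - t ^ 2) * (1 - Cmod z ^ 2)).
  { rewrite !Cmod2_alt. destruct z. unfold Re, Im. simpl. ring. }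
  assert (0 <= (1 - t ^ 2) * (1 - Cmod z ^ 2)) by (apply Rmult_le_pos; nra).
  unfold Rsqr. nra.
Qed.

(** Coefficients of the primitive of (z + t) / (1 + t z) vanishing at 0; for
    t = 1 it is the identity map. *)
Definition extremal_coeff (t : R) (n : nat) : C :=
  match n with O => 0%C | S m => (blaschke_coeff t m / RtoC (INR (S m)))%C end.

Lemma CPS_derive_extremal_coeff (t : R) (n : nat) :
  CPS_derive (extremal_coeff t) n = blaschke_coeff t n.
Proof.
  unfold CPS_derive, extremal_coeff. field.
  intros E. apply RtoC_inj in E. revert E. apply not_0_INR. lia.
Qed.

Lemma Cmod_extremal_coeff_le (t : R) (n : nat) : 0 <= t <= 1 -> Cmod (extremal_coeff t n) <= 1.
Proof.
  intros Ht. destruct n as [|m]; unfold extremal_coeff.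
  - rewrite Cmod_0. lra.
  - assert (Hm : 1 <= INR (S m)) by (rewrite S_INR; pose proof (pos_INR m); lra).
    assert (Hb : Cmod (blaschke_coeff t m) <= 1).
    { destruct m as [|m]; unfold blaschke_coeff.
      - rewrite Cmod_R, Rabs_pos_eq; lra.
      - rewrite Cmod_R, Rabs_mult, <- RPow_abs, Rabs_Ropp, !Rabs_pos_eq by nra.
        assert (0 <= t ^ m <= 1).
        { split; [apply pow_le; lra|]. rewrite <- (pow1 m). apply pow_incr. exact Ht. }
        nra. }
    rewrite Cmod_div, Cmod_R, Rabs_pos_eq; [|lra|].
    + apply Rle_div_l; lra.
    + intros E. apply RtoC_inj in E. lra.
Qed.

(** The primitive involves a logarithm; taking the sum of its power series as
    the definition avoids it, and termwise differentiation returns the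
    rational function whose modulus is known. *)
Lemma extremal_function (t : R) : 0 <= t <= 1 ->
  exists omega : C -> C, B0' omega /\ has_expansion omega (extremal_coeff t).
Proof.
  intros Ht.
  set (omega := fun z => epsilon (inhabits (RtoC 0)) (fun l => Cpseries (extremal_coeff t) z l)).
  assert (Hexp : forall z, unit_disk z -> Cpseries (extremal_coeff t) z (omega z)).
  { intros z Hz. unfold omega. apply epsilon_spec.
    pose proof (Cmod_ge_0 z).
    destruct (ex_Cseries_le (fun n => z ^ n * extremal_coeff t n)%C (fun n => Cmod z ^ n)) as [l Hl].
    - intros n. rewrite Cmod_mult, Cmod_pow. rewrite <- (Rmult_1_r (Cmod z ^ n)) at 2.
      apply Rmult_le_compat_l; [now apply pow_le | now apply Cmod_extremal_coeff_le].
    - apply ex_series_geom. rewrite Rabs_pos_eq by assumption. exact Hz.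
    - exists l. now apply Cpseries_Cseries. }
  exists omega.
  assert (Hhas : has_expansion omega (extremal_coeff t)) by (split; [reflexivity | exact Hexp]).
  split; [|exact Hhas]. split; [|split].
  - intros z Hz. exact (proj2 (is_derive_Cpseries_C_derive _ _ _ Hexp Hz)).
  - now exists (extremal_coeff t).
  - intros z Hz. destruct (is_derive_Cpseries_C_derive _ _ _ Hexp Hz) as [Hd _].
    apply (is_pseries_ext _ _ _ _ (CPS_derive_extremal_coeff t)) in Hd.
    apply Cpseries_Cseries in Hd.
    pose proof (proj1 (Cpseries_Cseries _ _ _) (Cpseries_blaschke t z Ht Hz)) as Hb.
    rewrite (Cseries_unique _ _ _ Hd Hb). now apply Cmod_blaschke_le.
Qed.

Theorem theorem3 :
  (forall (omega : C -> C) (c : nat -> C),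
     B0' omega -> has_expansion omega c ->
     0 <= Cmod (c 1%nat) <= 1 /\
     Cmod (c 1%nat * c 3%nat - c 2%nat * c 2%nat)%C
       <= 1 / 12 * (1 - Cmod (c 1%nat) ^ 2) * (3 + Cmod (c 1%nat) ^ 2))
  /\
  (forall t : R, 0 <= t <= 1 ->
     exists (omega : C -> C) (c : nat -> C),
       B0' omega /\ has_expansion omega c /\ Cmod (c 1%nat) = t /\
       Cmod (c 1%nat * c 3%nat - c 2%nat * c 2%nat)%C
         = 1 / 12 * (1 - Cmod (c 1%nat) ^ 2) * (3 + Cmod (c 1%nat) ^ 2)).
Proof.
  split; [exact B0'_hankel_bound|].
  intros t Ht. destruct (extremal_function t Ht) as (omega & Hom & Hexp).
  exists omega, (extremal_coeff t).
  assert (E1 : extremal_coeff t 1 = RtoC t) by (simpl; field).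
  assert (E1' : Cmod (extremal_coeff t 1) = t) by (rewrite E1, Cmod_R, Rabs_pos_eq; lra).
  split; [exact Hom|]. split; [exact Hexp|]. split; [exact E1'|].
  rewrite E1', E1.
  replace (t * extremal_coeff t 3 - extremal_coeff t 2 * extremal_coeff t 2)%C
    with (RtoC (- (1 / 12 * (1 - t ^ 2) * (3 + t ^ 2)))).
  - rewrite Cmod_R, Rabs_Ropp, Rabs_pos_eq; [reflexivity|].
    assert (0 <= t ^ 2 <= 1) by nra. nra.
  - unfold extremal_coeff, blaschke_coeff, Cdiv. rewrite <- !RtoC_inv by (simpl; lra). rewrite <- !RtoC_mult, <- RtoC_minus.
    f_equal. simpl INR. field.
Qed.
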